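(* Let $\mathcal{M}$ be a smooth manifold of positive dimension, let $p,p'\ge 0$ be integers with $p+p'=\dim\mathcal{M}$, and for $x\in\mathcal{M}$ let $\Gamma_x$ be the space of all scalar products of signature $(p,p')$ on $T_x\mathcal{M}$. Fix $x_0\in\mathcal{M}$ and an invariant measure $d\mu_{x_0}$ on $\Gamma_{x_0}$. For every $x\in\mathcal{M}$ put $$d\mu_x:=(l_x^* )_\star\, d\mu_{x_0},$$ where $l_x:T_x\mathcal{M}\to T_{x_0}\mathcal{M}$ is any linear isomorphism and $l_x^*:\Gamma_{x_0}\to\Gamma_x$ is the corresponding pull-back. Then $d\mu_x$ does not depend on the choice of $l_x$, each $d\mu_x$ is an invariant measure on $\Gamma_x$, and the measure field $x\mapsto d\mu_x$ is diffeomorphism invariant: for every diffeomorphism $\chi:\mathcal{M}\to\mathcal{M}$ and every $x\in\mathcal{M}$, $$(\chi d\mu)_x=d\mu_x .$$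
   Context: A scalar product on a finite-dimensional real vector space $V$ is a non-degenerate symmetric bilinear form; its signature is $(p,p')$ if an orthonormal basis has $p$ vectors of square $+1$ and $p'$ of square $-1$. The set $\Gamma$ of scalar products of signature $(p,p')$ on $V$ is an open subset of the vector space of symmetric bilinear forms on $V$ and carries the induced topology and manifold structure. $GL(V)$ acts on $\Gamma$ by $\bar g(\gamma)=(g^{-1})^*\gamma$, i.e. $(\bar g\gamma)(v,v')=\gamma(g^{-1}v,g^{-1}v')$. For a linear isomorphism $l:V\to W$, the pull-back $l^*$ sends a scalar product $\gamma$ on $W$ to the scalar product $(l^*\gamma)(v,v')=\gamma(lv,lv')$ on $V$. ''Measure'' means regular Borel measure; for a homeomorphism $\varphi$, $\varphi_\star d\mu$ is the pushforward measure, $\int f\,(\varphi_\star d\mu)=\int (f\circ\varphi)\,d\mu$ for continuous compactly supported $f$. A measure $d\mu$ on $\Gamma$ is invariant if $\bar g_\star d\mu=d\mu$ for all $g\in GL(V)$. A measure field on $\mathcal{M}$ is an assignment $x\mapsto d\mu_x$ of a measure on $\Gamma_x$ to each $x\in\mathcal{M}$. A diffeomorphism $\chi$ of $\mathcal{M}$ transforms it to the measure field $(\chi d\mu)_x:=\big((T_x\chi)^*\big)_\star\, d\mu_{\chi(x)}$, where $T_x\chi:T_x\mathcal{M}\to T_{\chi(x)}\mathcal{M}$ is the tangent map and $(T_x\chi)^*:\Gamma_{\chi(x)}\to\Gamma_x$ is its pull-back. *)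

(* Defs.v *)
From HB Require Import structures.
From mathcomp Require Import all_boot all_order all_algebra.
From mathcomp Require Import ring.
From mathcomp Require Import all_classical all_reals all_analysis.

Set Implicit Arguments.
Unset Strict Implicit.
Unset Printing Implicit Defensive.

Import Order.TTheory GRing.Theory Num.Theory.
Import numFieldNormedType.Exports.

Local Open Scope classical_set_scope.
Local Open Scope ring_scope.

Section LinearIsomorphisms.
Variable R : realType.

Record linIso (V W : vectType R) := LinIso {
  iso_fun :> 'Hom(V, W);
  iso_bij : bijective iso_fun }.

Lemma linIso_lker0 (V W : vectType R) (l : linIso V W) : lker l == 0%VS.
Proof. by apply/lker0P; exact: bij_inj (iso_bij l). Qed.

Lemma linIso_K (V W : vectType R) (l : linIso V W) : cancel l (l^-1)%VF.
Proof. by move=> v; exact: lker0_lfunK (linIso_lker0 l) v. Qed.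

Lemma linIso_VK (V W : vectType R) (l : linIso V W) : cancel (l^-1)%VF l.
Proof.
move=> w; have [k lk kl] := iso_bij l.
by rewrite -[in LHS](kl w) linIso_K kl.
Qed.

Lemma linIso_inv_bij (V W : vectType R) (l : linIso V W) :
  bijective (l^-1)%VF.
Proof. by exists l; [exact: linIso_VK | exact: linIso_K]. Qed.

Definition linIso_inv (V W : vectType R) (l : linIso V W) : linIso W V :=
  LinIso (linIso_inv_bij l).

Lemma inj_dim_bij (V W : vectType R) (f : 'Hom(V, W)) :
  injective f -> \dim {:V} = \dim {:W} -> bijective f.
Proof.
move=> /lker0P f0 dVW.
have fT : limg f = fullv.
  by apply/eqP; rewrite eqEdim subvf /= (limg_dim_eq) ?dVW// (eqP f0) capv0.
exists (f^-1)%VF => [v|w]; first exact: lker0_lfunK.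
by rewrite limg_lfunVK// fT memvf.
Qed.

End LinearIsomorphisms.

Section ScalarProducts.
Variable R : realType.

Definition orthonormal_basis (V : vectType R) (g : {symmetric V}) (e : seq V) :=
  [/\ basis_of fullv e, pairwise_orthogonal g e &
      {in e, forall v, g v v = 1 \/ g v v = -1}].

Definition has_signature (p p' : nat) (V : vectType R) (g : {symmetric V}) :=
  exists e : seq V, [/\ orthonormal_basis g e,
    count [pred v | g v v == 1] e = p & count [pred v | g v v == -1] e = p'].

Record scalarProd (p p' : nat) (V : vectType R)
    (hV : \dim {:V} = (p + p')%N) := ScalarProd {
  sp_form :> {symmetric V};
  sp_nondegenerate : nondegenerate sp_form;
  sp_signature : has_signature p p' sp_form }.

Lemma sp_inj (p p' : nat) (V : vectType R) (hV : \dim {:V} = (p + p')%N)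
  (a b : scalarProd hV) : (forall v w, a v w = b v w) -> a = b.
Proof.
case: a b => [[a ca] na sa] [[b cb] nb sb] /= ab.
have eab : a = b by apply/funext => v; apply/funext => w; exact: ab.
subst b.
have ec : ca = cb.
  case: ca cb {na sa nb sb ab} => [[? ? ? ?] [?]] [[? ? ? ?] [?]].
  by do 2 f_equal; apply: Prop_irrelevance.
subst cb.
by f_equal; apply: Prop_irrelevance.
Qed.

(* The standard form diag(1, ..., 1, -1, ..., -1) in a basis; it is only used as
   the base point required of measurable spaces by the library. *)
Section StandardForm.
Variables (p p' : nat) (V : vectType R) (hV : \dim {:V} = (p + p')%N).

Let e := vbasis {:V}.
Let sgn (i : 'I_(\dim {:V})) : R := if (i < p)%N then 1 else -1.

Definition std_form (v w : V) : R :=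
  \sum_(i < \dim {:V}) sgn i * coord e i v * coord e i w.

Lemma std_form_bilinear :
  bilinear_for (GRing.Scale.Law.clone _ _ ( *%R ) _)
    (GRing.Scale.Law.clone _ _ (@idfun R \; *%R ) _) std_form.
Proof.
split=> [w a u v|u a v w] /=; rewrite /std_form mulr_sumr -big_split /=;
  apply: eq_bigr => i _; rewrite linearP /=.
- by ring.
- by ring.
Qed.

Lemma std_form_sym (v w : V) :
  std_form v w = (-1) ^+ false * idfun (std_form w v).
Proof.
rewrite expr0 mul1r /=; apply: eq_bigr => i _.
by rewrite -mulrA (mulrC (coord _ _ v)) mulrA.
Qed.

HB.instance Definition _ :=
  bilinear_isBilinear.Build R V V R _ _ std_form std_form_bilinear.
HB.instance Definition _ :=
  isHermitianSesquilinear.Build R V false idfun std_form std_form_sym.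

Lemma std_form_basis (i j : 'I_(\dim {:V})) :
  std_form e`_i e`_j = sgn i * (i == j)%:R.
Proof.
have ef : free e := basis_free (vbasisP _).
rewrite /std_form (bigD1 i)//= !coord_free// eqxx mulr1 big1 ?addr0.
  by rewrite eq_sym.
by move=> k ki; rewrite coord_free// eq_sym (negPf ki) mulr0 mul0r.
Qed.

Lemma std_nondegenerate : nondegenerate std_form.
Proof.
rewrite /nondegenerate -subv0; apply/subvP => v /mem_orthovP vo.
rewrite memv0 (coord_vbasis (memvf v)) big1// => i _.
have /eqP := vo e`_i (memvf _).
rewrite /= /std_form (bigD1 i)//= big1 ?addr0.
  rewrite [X in _ * X]coord_free ?(basis_free (vbasisP _))//.
  rewrite eqxx mulr1 mulf_eq0 => /orP[|/eqP ->]; last by rewrite scale0r.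
  by rewrite /sgn; case: ifP => _; rewrite ?oppr_eq0 oner_eq0.
move=> k ki; rewrite [X in _ * X]coord_free ?(basis_free (vbasisP _))//.
by rewrite eq_sym (negPf ki) mulr0.
Qed.

Lemma std_signature : has_signature p p' std_form.
Proof.
have sz : size e = \dim {:V} by rewrite size_tuple.
have eE (P : pred V) : count P e = count (fun i : 'I_(\dim {:V}) => P e`_i)
    (enum 'I_(\dim {:V})).
  rewrite -[in LHS](mkseq_nth 0 e) sz /mkseq -val_enum_ord -map_comp count_map.
  by apply: eq_count.
have ct (P : pred nat) : count (fun i : 'I_(\dim {:V}) => P i)
    (enum 'I_(\dim {:V})) = count P (iota 0 (p + p')).
  by rewrite -hV -val_enum_ord count_map.
have n2 : ((1 : R) == -1) = false by rewrite -addr_eq0 -mulr2n pnatr_eq0.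
have n1 : ((-1 : R) == 1) = false by rewrite eq_sym.
exists e; split; first split.
- exact: vbasisP.
- rewrite /pairwise_orthogonal; apply/andP; split.
    by apply/negP => /(basis_not0 (vbasisP _)); rewrite eqxx.
  suff H (s : seq 'I_(\dim {:V})) : uniq s ->
      pair_ortho_rec (std_form : {symmetric V}) [seq e`_(val i) | i <- s].
    have := H (enum 'I_(\dim {:V})) (enum_uniq _).
    have em := mkseq_nth 0 e; rewrite size_tuple in em.
    by rewrite (map_comp (nth 0 e) val) val_enum_ord; rewrite /mkseq in em; rewrite em.
  elim: s => //= i s IH /andP[isn us]; rewrite IH// andbT /ortho_rec /= andbT.
  apply/allP => _ /mapP[j js ->] /=; rewrite std_form_basis.
  have ij : i != j by apply: contraNneq isn => ->.
  by rewrite (negPf ij) mulr0.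
- move=> v /(nthP 0)[i]; rewrite sz => iV <-.
  suff : std_form e`_i e`_i = 1 \/ std_form e`_i e`_i = -1 by [].
  have -> := std_form_basis (Ordinal iV) (Ordinal iV); rewrite eqxx mulr1.
  by rewrite /sgn; case: ifP; [left|right].
- rewrite eE -[RHS]add0n.
  rewrite (@eq_count _ _ (fun i : 'I__ => (i < p)%N)); last first.
    move=> i /=; rewrite std_form_basis eqxx mulr1 /sgn; case: ifP => _ //.
    by rewrite eqxx.
  rewrite (ct (fun i => (i < p)%N)) iotaD count_cat addnC; congr (_ + _)%N.
    apply/eqP; rewrite -leqn0 leqNgt -has_count; apply/hasPn => i.
    by rewrite mem_iota add0n -leqNgt => /andP[].
  rewrite -[RHS](size_iota 0); apply/eqP; rewrite -all_count; apply/allP => i.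
  by rewrite mem_iota.
- rewrite eE -[RHS]add0n.
  rewrite (@eq_count _ _ (fun i : 'I__ => (p <= i)%N)); last first.
    move=> i /=; rewrite std_form_basis eqxx mulr1 /sgn [(p <= i)%N]leqNgt.
    by case: ifP => _; rewrite ?n2 ?eqxx.
  rewrite (ct (fun i => (p <= i)%N)) iotaD count_cat; congr (_ + _)%N.
    apply/eqP; rewrite -leqn0 leqNgt -has_count; apply/hasPn => i.
    by rewrite mem_iota add0n -ltnNge.
  rewrite -[RHS](size_iota p); apply/eqP; rewrite -all_count; apply/allP => i.
  by rewrite mem_iota add0n => /andP[].
Qed.

Definition std_scalarProd : scalarProd hV :=
  ScalarProd hV std_nondegenerate std_signature.

End StandardForm.

Section PullBack.
Variables (p p' : nat) (V W : vectType R).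
Variables (hV : \dim {:V} = (p + p')%N) (hW : \dim {:W} = (p + p')%N).

Definition pullback_form (l : 'Hom(V, W)) (g : {symmetric W}) (v v' : V) : R :=
  g (l v) (l v').

Section Form.
Variables (l : 'Hom(V, W)) (g : {symmetric W}).

Lemma pullback_form_bilinear :
  bilinear_for (GRing.Scale.Law.clone _ _ ( *%R ) _)
    (GRing.Scale.Law.clone _ _ (@idfun R \; *%R ) _) (pullback_form l g).
Proof.
split=> [w a u v|u a v w] /=; rewrite /pullback_form linearP.
- by rewrite linearDl linearZl_LR.
- by rewrite linearD linearZ.
Qed.

Lemma pullback_form_sym (v w : V) :
  pullback_form l g v w = (-1) ^+ false * idfun (pullback_form l g w v).
Proof. exact: hermitian_subproof. Qed.

HB.instance Definition _ :=
  bilinear_isBilinear.Build R V V R _ _ (pullback_form l g)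
    pullback_form_bilinear.
HB.instance Definition _ :=
  isHermitianSesquilinear.Build R V false idfun (pullback_form l g)
    pullback_form_sym.

End Form.

Lemma pullback_nondegenerate (l : linIso V W) (g : {symmetric W}) :
  nondegenerate g -> nondegenerate (pullback_form l g).
Proof.
move=> /eqP g0; rewrite /nondegenerate -subv0.
apply/subvP => v /mem_orthovP vo.
suff : l v \in orthov g fullv.
  by rewrite g0 !memv0 => /eqP lv; rewrite -(linIso_K l v) lv linear0.
apply/mem_orthovP => w _; rewrite -(linIso_VK l w); exact: vo (memvf _).
Qed.

Lemma pullback_signature (l : linIso V W) (g : {symmetric W}) :
  has_signature p p' g -> has_signature p p' (pullback_form l g).
Proof.
move=> [e [[be oe ne] ce ce']].
pose k := linIso_inv l; exists (map k e).
have gk v w : pullback_form l g (k v) (k w) = g v w.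
  by rewrite /pullback_form !linIso_VK.
split; first split.
- rewrite basisEdim size_map; apply/andP; split.
    rewrite -limg_span (span_basis be); apply/subvP => v _.
    by rewrite -(linIso_K l v); apply: memv_img; rewrite memvf.
  by rewrite hV -hW (size_basis (X := in_tuple e) be).
- case/andP: oe => e0 oe; apply/andP; split.
    apply/negP => /mapP[v ve k0]; case/negP: e0.
    by rewrite -(linIso_VK l v) -[(l^-1)%VF v]/(k v) -k0 linear0 in ve.
  elim: e oe {be e0 ne ce ce'} => //= v e IH /andP[/andP[oe _] /IH ->].
  rewrite andbT /ortho_rec /= andbT; apply/allP => _ /mapP[w we ->] /=.
  suff : pullback_form l g (k v) (k w) == 0 by [].
  by rewrite gk; exact: (allP oe).
- by move=> _ /mapP[v ve ->]; have := ne v ve; rewrite -gk.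
- by rewrite count_map -ce; apply: eq_count => v /=; rewrite -gk.
- by rewrite count_map -ce'; apply: eq_count => v /=; rewrite -gk.
Qed.

Definition pullback (l : linIso V W) (g : scalarProd hW) : scalarProd hV :=
  ScalarProd hV (pullback_nondegenerate l (sp_nondegenerate g))
    (pullback_signature l (sp_signature g)).

End PullBack.

End ScalarProducts.

Section GammaTopology.
Variables (R : realType) (p p' : nat) (V : vectType R).
Variable hV : \dim {:V} = (p + p')%N.

HB.instance Definition _ := gen_eqMixin (scalarProd hV).
HB.instance Definition _ := gen_choiceMixin (scalarProd hV).
HB.instance Definition _ := isPointed.Build (scalarProd hV) (std_scalarProd hV).

(* Gram matrices in a basis of V identify the vector space of symmetric bilinear
   forms on V with that of symmetric matrices; the topology does not depend on
   the basis. *)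
Definition gram (g : scalarProd hV) : 'M[R]_(\dim {:V}) :=
  \matrix_(i, j) g (vbasis {:V})`_i (vbasis {:V})`_j.

HB.instance Definition _ :=
  Topological.copy (scalarProd hV) (initial_topology gram).

End GammaTopology.

Section PullbackContinuous.
Variables (R : realType) (p p' : nat) (V W : vectType R).
Variables (hV : \dim {:V} = (p + p')%N) (hW : \dim {:W} = (p + p')%N).

Lemma eval_continuous (v w : W) :
  continuous (fun g : scalarProd hW => g v w : R).
Proof.
pose c i := coord (vbasis {:W}) i.
have -> : (fun g : scalarProd hW => g v w : R) =
    (fun g => \sum_i \sum_j c i v * (c j w * gram g i j)).
  apply/funext => g; rewrite {1}(coord_vbasis (memvf v)) linear_sumlz.
  apply: eq_bigr => i _; rewrite linearZl_LR /= -mulr_sumr; congr (_ * _).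
  rewrite {1}(coord_vbasis (memvf w)) linear_sumr.
  by apply: eq_bigr => j _; rewrite linearZr_LR mxE.
move=> g; have Fg : Filter (nbhs g) by exact: nbhs_filter.
apply: (@cvg_big _ _ +%R 0 predT _ _ (nbhs g)) => [|i _]; first exact: add_continuous.
apply: (@cvg_big _ _ +%R 0 predT _ _ (nbhs g)) => [|j _]; first exact: add_continuous.
apply: cvgMl_tmp; apply: cvgMl_tmp.
apply: (cvg_comp (@gram R p p' W hW) (fun M => M i j)).
  exact: initial_continuous.
exact: coord_continuous.
Qed.

Lemma pullback_continuous (l : linIso V W) :
  continuous (pullback hV l : scalarProd hW -> scalarProd hV).
Proof.
apply: (@continuous_comp_initial _ _ _ (@gram R p p' V hV)) => g U [P gP sPU].
rewrite nbhs_simpl /=; near=> h; apply: sPU => i j.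
rewrite mxE; move: i j.
near: h.
apply: filter_forall => i; apply: filter_forall => j.
have := gP i j; rewrite !mxE; exact: eval_continuous.
Unshelve. all: by end_near. Qed.

End PullbackContinuous.

Section BorelMeasures.

Definition borelType (T : ptopologicalType) := g_sigma_algebraType (@open T).

Definition borelMeasure (R : realType) (T : ptopologicalType) :=
  {measure set (borelType T) -> \bar R}.

Lemma continuous_borel (S T : ptopologicalType) (f : S -> T) :
  continuous f ->
  measurable_fun [set: borelType S] (f : borelType S -> borelType T).
Proof.
move=> /continuousP cf.
apply: (@measurability _ _ (borelType S) (borelType T) setT f open) => //.
move=> _ [A oA <-]; rewrite setTI; apply: sub_sigma_algebra; exact: cf.
Qed.

(* The library's pushforward mu f, packed with its measure structure. *)
Definition push_borel (R : realType) (S T : ptopologicalType) (f : S -> T)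
    (cf : continuous f) (mu : borelMeasure R S) : borelMeasure R T :=
  measure_function_pushforward__canonical__measure_function_Measure mu
    (continuous_borel cf).

(* Inner regularity is required of all Borel sets; on Gamma, which is
   sigma-compact, this is no stronger than requiring it of open sets. *)
Definition regular_measure (R : realType) (T : ptopologicalType)
    (mu : borelMeasure R T) :=
  [/\ forall K : set T, compact K -> (mu K < +oo)%E,
      forall A : set (borelType T), measurable A ->
        mu A = ereal_inf [set mu U | U in [set U : set T | open U /\ A `<=` U]] &
      forall A : set (borelType T), measurable A ->
        mu A =
          ereal_sup [set mu K | K in [set K : set T | compact K /\ K `<=` A]]].

(* The values of a library measure on non-measurable sets carry no meaning. *)
Definition eq_borel (R : realType) (T : ptopologicalType)
    (mu nu : borelMeasure R T) :=
  forall A : set (borelType T), measurable A -> mu A = nu A.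

End BorelMeasures.

Section InvariantMeasures.
Variables (R : realType) (p p' : nat) (V W : vectType R).
Variables (hV : \dim {:V} = (p + p')%N) (hW : \dim {:W} = (p + p')%N).

Definition push_pullback (l : linIso V W) (mu : borelMeasure R (scalarProd hW)) :
    borelMeasure R (scalarProd hV) :=
  push_borel (@pullback_continuous _ _ _ _ _ hV hW l) mu.

End InvariantMeasures.

Definition GL_act (R : realType) (p p' : nat) (V : vectType R)
    (hV : \dim {:V} = (p + p')%N) (g : linIso V V) :
    scalarProd hV -> scalarProd hV :=
  pullback hV (linIso_inv g).
Arguments GL_act {R p p' V} hV g _.

Lemma GL_act_continuous (R : realType) (p p' : nat) (V : vectType R)
    (hV : \dim {:V} = (p + p')%N) (g : linIso V V) :
  continuous (GL_act hV g).
Proof. exact: pullback_continuous. Qed.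
Arguments GL_act_continuous {R p p' V} hV g _ _ _.

Definition invariant_measure (R : realType) (p p' : nat) (V : vectType R)
    (hV : \dim {:V} = (p + p')%N) (mu : borelMeasure R (scalarProd hV)) :=
  regular_measure mu /\
  forall g : linIso V V, eq_borel (push_borel (GL_act_continuous hV g) mu) mu.

Section SmoothMaps.
Variables (R : realType) (U W : normedModType R).

(* In finite dimension, differentiability together with C^k directional
   derivatives is C^(k+1). *)
Fixpoint Ck_on (k : nat) (A : set U) (f : U -> W) : Prop :=
  if k is k'.+1 then
    (forall x, A x -> differentiable f x) /\
    (forall v, Ck_on k' A (fun x => 'D_v f x))
  else forall x, A x -> {for x, continuous f}.

(* Meant for open sets A; f is an arbitrary total extension outside A. *)
Definition smooth_on (A : set U) (f : U -> W) := forall k, Ck_on k A f.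

End SmoothMaps.

(* chart_inv is total; only its values on chart_map @` chart_dom matter. *)
Record chart (R : realType) (n : nat) (T : topologicalType) := Chart {
  chart_dom : set T;
  chart_map :> T -> 'rV[R]_n;
  chart_inv : 'rV[R]_n -> T;
  chart_dom_open : open chart_dom;
  chart_cod_open : open (chart_map @` chart_dom);
  chart_invK : forall x, chart_dom x -> chart_inv (chart_map x) = x;
  chart_continuous : forall x, chart_dom x -> {for x, continuous chart_map};
  chart_inv_continuous : forall x, chart_dom x ->
    {for chart_map x, continuous chart_inv} }.

Record smoothManifold (R : realType) (n : nat) := SmoothManifold {
  manifold_space :> topologicalType;
  manifold_hausdorff : hausdorff_space manifold_space;
  manifold_second_countable : @second_countable manifold_space;
  atlas : set (chart R n manifold_space);
  atlas_cover : forall x, exists2 c, atlas c & chart_dom c x;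
  atlas_smooth : forall c d, atlas c -> atlas d ->
    smooth_on (c @` (chart_dom c `&` chart_dom d)) (d \o chart_inv c) }.

Definition smooth_map (R : realType) (n : nat) (M N : smoothManifold R n) (f : M -> N) :=
  continuous f /\
  forall c d, atlas (s := M) c -> atlas (s := N) d ->
    smooth_on (c @` (chart_dom c `&` f @^-1` chart_dom d))
      (d \o f \o chart_inv c).

Record diffeomorphism (R : realType) (n : nat) (M N : smoothManifold R n) := Diffeomorphism {
  diffeo_fun :> M -> N;
  diffeo_inv : N -> M;
  diffeo_funK : cancel diffeo_fun diffeo_inv;
  diffeo_invK : cancel diffeo_inv diffeo_fun;
  diffeo_smooth : smooth_map diffeo_fun;
  diffeo_inv_smooth : smooth_map diffeo_inv }.

Section Differentials.
Variable R : realType.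

Lemma near_eq_diff (U W : normedModType R) (f g : U -> W) (a : U) :
  (\near a, f a = g a) -> differentiable f a -> 'd g a = 'd f a :> (U -> W).
Proof.
move=> fg df; have fga := nbhs_singleton fg.
apply: diff_unique; first exact: diff_continuous.
have /eqaddoP dfo := diff_locally df.
have fg0 : \forall h \near (0 : U), f (h + a) = g (h + a).
  by move/nbhs0P: fg; apply: filterS => h; rewrite addrC.
apply/eqaddoP => e e0; have := dfo e e0.
move=> dfe; apply: filterS2 fg0 dfe => h hE.
by rewrite !fctE /= hE fga.
Qed.

Lemma chart_near_dom (n : nat) (T : topologicalType) (c : chart R n T) (x : T)
  (A : set T) : chart_dom c x -> nbhs x A ->
  \forall y \near c x, A (chart_inv c y).
Proof.
move=> cx Ax; have := chart_inv_continuous cx.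
by rewrite /prop_for /continuous_at (chart_invK cx) => /(_ _ Ax).
Qed.

Lemma chart_diff_comp (n : nat) (M N P : topologicalType) (f : M -> N)
  (g : N -> P) (x : M) (a : chart R n M) (b : chart R n N) (c : chart R n P) :
  chart_dom a x -> chart_dom b (f x) -> {for x, continuous f} ->
  differentiable (b \o f \o chart_inv a) (a x) ->
  differentiable (c \o g \o chart_inv b) (b (f x)) ->
  'd (c \o (g \o f) \o chart_inv a) (a x) =
    'd (c \o g \o chart_inv b) (b (f x)) \o 'd (b \o f \o chart_inv a) (a x)
    :> (_ -> _).
Proof.
move=> ax bfx cf df dg.
have bE : (b \o f \o chart_inv a) (a x) = b (f x) by rewrite /= chart_invK.
have fg : \forall y \near a x, ((c \o g \o chart_inv b) \o
    (b \o f \o chart_inv a)) y = (c \o (g \o f) \o chart_inv a) y.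
  have : nbhs x (f @^-1` chart_dom b).
    by apply: cf; apply: open_nbhs_nbhs; split=> //; exact: chart_dom_open.
  move=> /(chart_near_dom ax); apply: filterS => y /= by_.
  by rewrite chart_invK.
move: (b \o f \o chart_inv a) (c \o g \o chart_inv b)
  (c \o (g \o f) \o chart_inv a) (b (f x)) (a x) bE fg df dg.
move=> F G H y z Fz; rewrite -{}Fz => FG dF dG.
have E := diff_comp dF dG.
have D := differentiable_comp dF dG.
by rewrite -E; exact: near_eq_diff FG D.
Qed.

Lemma chart_diff_id (n : nat) (T : topologicalType) (c : chart R n T) (x : T) :
  chart_dom c x -> 'd (c \o chart_inv c) (c x) = id :> (_ -> _).
Proof.
move=> cx; rewrite (near_eq_diff (f := id)); first exact: diff_val.
  have : nbhs (c x) (c @` chart_dom c).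
    by apply: open_nbhs_nbhs; split; [exact: chart_cod_open | exists x].
  by apply: filterS => _ [y cy <-] /=; rewrite chart_invK.
exact: ex_diff.
Qed.

End Differentials.

Section TangentSpace.
Variables (R : realType) (n : nat) (M : smoothManifold R n) (x : M).

Record chart_at := ChartAt {
  chart_at_chart :> chart R n M;
  chart_at_atlas : atlas chart_at_chart;
  chart_at_dom : chart_dom chart_at_chart x }.

(* A tangent vector is given by its components in all the charts around x,
   related by the Jacobians of the coordinate changes. *)
Definition tangent_compat (v : chart_at -> 'rV[R]_n) :=
  forall c d : chart_at, v d = 'd (d \o chart_inv c) (c x) (v c).

Definition tangent_pred : {pred chart_at -> 'rV[R]_n} :=
  [pred v | `[< tangent_compat v >]].

Lemma tangent_submod_closed : submod_closed tangent_pred.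
Proof.
split; first by apply/asboolP => c d; rewrite linear0.
move=> a u v /asboolP cu /asboolP cv; apply/asboolP => c d.
by rewrite linearP; congr (a *: _ + _); [exact: cu | exact: cv].
Qed.

HB.instance Definition _ :=
  GRing.isSubmodClosed.Build R (chart_at -> 'rV[R]_n) tangent_pred
    (GRing.submod_closed_semi tangent_submod_closed).

Record tangent := Tangent {
  tangent_comp :> chart_at -> 'rV[R]_n;
  _ : tangent_comp \in tangent_pred }.

HB.instance Definition _ := [isSub for tangent_comp].
HB.instance Definition _ := [Choice of tangent by <:].
HB.instance Definition _ := [SubChoice_isSubLmodule of tangent by <:].

Lemma chart_at_inhabited : exists c : chart_at, True.
Proof. by have [c ac cx] := atlas_cover x; exists (ChartAt ac cx). Qed.

Definition chart0 : chart_at := projT1 (cid chart_at_inhabited).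

Lemma tangentP (v : tangent) : tangent_compat v.
Proof. by case: v => v vP; have /asboolP := vP. Qed.

Lemma transition_differentiable (c d : chart_at) :
  differentiable (d \o chart_inv c) (c x).
Proof.
have [+ _] := atlas_smooth (chart_at_atlas c) (chart_at_atlas d) 1%N.
by apply; exists x => //; split; exact: chart_at_dom.
Qed.

Lemma transition_comp (c d e : chart_at) (v : 'rV[R]_n) :
  'd (e \o chart_inv c) (c x) v =
    'd (e \o chart_inv d) (d x) ('d (d \o chart_inv c) (c x) v).
Proof.
have := @chart_diff_comp R n M M M id id x c d e (chart_at_dom c)
  (chart_at_dom d) _ (transition_differentiable c d)
  (transition_differentiable d e).
by move=> /(_ (fun A => id)) /(congr1 (fun h => h v)).
Qed.

Definition tangent_of (c : chart_at) (v : 'rV[R]_n) : chart_at -> 'rV[R]_n :=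
  fun d => 'd (d \o chart_inv c) (c x) v.

Lemma tangent_of_subproof (c : chart_at) (v : 'rV[R]_n) :
  tangent_of c v \in tangent_pred.
Proof. by apply/asboolP => d e; exact: transition_comp. Qed.

Lemma tangent_finDim : Vector.axiom n tangent.
Proof.
exists (fun v : tangent => v chart0) => //.
exists (fun w => Tangent (tangent_of_subproof chart0 w)) => [v|w].
  by apply/val_inj/funext => d; rewrite /= /tangent_of -(tangentP v).
by rewrite /= /tangent_of chart_diff_id//; exact: chart_at_dom.
Qed.

HB.instance Definition _ := Lmodule_hasFinDim.Build R tangent tangent_finDim.

Lemma tangent_dim : \dim {:tangent} = n.
Proof. by rewrite dimvf. Qed.

End TangentSpace.

Arguments tangent {R n} M x.

Lemma tangent_linIso_exists (R : realType) (n : nat) (M : smoothManifold R n)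
  (x y : M) : inhabited (linIso (tangent M x) (tangent M y)).
Proof.
pose h (v : tangent M x) := Tangent (tangent_of_subproof (chart0 y) (v (chart0 x))).
have hlin : linear h.
  move=> a u v; apply/val_inj/funext => d.
  exact: (linearP ('d (d \o chart_inv (chart0 y)) (chart0 y y)) a).
pose H := HB.pack_for {linear tangent M x -> tangent M y} h
  (GRing.isLinear.Build _ _ _ _ h hlin).
have hinj : injective (linfun H).
  move=> u v; rewrite !lfunE /= => /(congr1 (fun w => tangent_comp w (chart0 y))).
  rewrite /= /tangent_of chart_diff_id => [/= uv|]; last exact: chart_at_dom.
  apply/val_inj/funext => d; apply: etrans (tangentP u (chart0 x) d) _.
  by rewrite uv; exact: esym (tangentP v (chart0 x) d).
have dxy : \dim {:tangent M x} = \dim {:tangent M y} by rewrite !tangent_dim.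
exact: inhabits (LinIso (inj_dim_bij hinj dxy)).
Qed.

Section TangentMap.
Variables (R : realType) (n : nat) (M N : smoothManifold R n).

Section Smooth.
Variables (f : M -> N) (sf : smooth_map f) (x : M).

Lemma smooth_map_differentiable (c : chart_at x) (d : chart_at (f x)) :
  differentiable (d \o f \o chart_inv c) (c x).
Proof.
have [_ /(_ _ _ (chart_at_atlas c) (chart_at_atlas d) 1%N)[+ _]] := sf.
by apply; exists x => //; split; [exact: chart_at_dom | exact: chart_at_dom].
Qed.

(* tangent_map_compE: the value does not depend on the chart around x. *)
Definition tangent_map_comp (v : tangent M x) : chart_at (f x) -> 'rV[R]_n :=
  fun d => 'd (d \o f \o chart_inv (chart0 x)) (chart0 x x) (v (chart0 x)).

Lemma tangent_map_compE (v : tangent M x) (c : chart_at x) (d : chart_at (f x)) :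
  tangent_map_comp v d = 'd (d \o f \o chart_inv c) (c x) (v c).
Proof.
rewrite [v c](tangentP v (chart0 x)) /tangent_map_comp.
have := @chart_diff_comp R n M M N id f x (chart0 x) c d (chart_at_dom _)
  (chart_at_dom c) (fun A => id) (transition_differentiable (chart0 x) c)
  (smooth_map_differentiable c d).
by move=> /(congr1 (fun h => h (v (chart0 x)))).
Qed.

Lemma tangent_map_subproof (v : tangent M x) :
  tangent_map_comp v \in @tangent_pred R n N (f x).
Proof.
apply/asboolP => d e; rewrite /tangent_map_comp.
have := @chart_diff_comp R n M N N f id x (chart0 x) d e (chart_at_dom _)
  (chart_at_dom d) (sf.1 x) (smooth_map_differentiable (chart0 x) d)
  (transition_differentiable d e).
by move=> /(congr1 (fun h => h (v (chart0 x)))).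
Qed.

Definition tangent_map (v : tangent M x) : tangent N (f x) :=
  Tangent (tangent_map_subproof v).

Lemma tangent_map_linear : linear tangent_map.
Proof.
move=> a u v; apply/val_inj/funext => d.
exact: (linearP ('d (d \o f \o chart_inv (chart0 x)) (chart0 x x)) a).
Qed.

HB.instance Definition _ :=
  GRing.isLinear.Build R (tangent M x) (tangent N (f x)) _ tangent_map
    tangent_map_linear.

End Smooth.

Lemma diffeo_tangent_inj (f : diffeomorphism M N) (x : M) :
  injective (linfun (tangent_map (diffeo_smooth f) (x := x))).
Proof.
move=> u v; rewrite !lfunE => uv; apply/val_inj/funext => c.
pose d := chart0 (f x).
have dg : differentiable (c \o diffeo_inv f \o chart_inv d) (d (f x)).
  have [_ /(_ _ _ (chart_at_atlas d) (chart_at_atlas c) 1%N)[+ _]] :=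
    diffeo_inv_smooth f.
  apply; exists (f x) => //; split; first exact: chart_at_dom.
  by rewrite /= diffeo_funK; exact: chart_at_dom.
have df := smooth_map_differentiable (diffeo_smooth f) c d.
have := @chart_diff_comp R n M N M f (diffeo_inv f) x c d c (chart_at_dom c)
  (chart_at_dom d) ((diffeo_smooth f).1 x) df dg.
have -> : diffeo_inv f \o f = id by apply/funext => z; exact: diffeo_funK.
move=> E; have {}E := etrans (esym (chart_diff_id (chart_at_dom c))) E.
have Ew w := congr1 (fun h => h w) E.
have huv := etrans (esym (tangent_map_compE (diffeo_smooth f) u c d))
  (etrans (congr1 (fun w : tangent N (f x) => w d) uv)
     (tangent_map_compE (diffeo_smooth f) v c d)).
exact: etrans (Ew (u c)) (etrans (congr1 _ huv) (esym (Ew (v c)))).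
Qed.

Definition tangent_iso (f : diffeomorphism M N) (x : M) :
    linIso (tangent M x) (tangent N (f x)) :=
  LinIso (inj_dim_bij (@diffeo_tangent_inj f x)
    (etrans (tangent_dim x) (esym (tangent_dim (f x))))).

End TangentMap.

Section MeasureFields.
Variables (R : realType) (n p p' : nat) (hpp : (p + p')%N = n).
Variable M : smoothManifold R n.

Lemma tangent_dim_signature (x : M) : \dim {:tangent M x} = (p + p')%N.
Proof. by rewrite tangent_dim hpp. Qed.

Definition Gamma (x : M) : ptopologicalType :=
  scalarProd (tangent_dim_signature x).

Definition measure_field := forall x : M, borelMeasure R (Gamma x).

(* (chi mu)_x is the image of mu_(chi x) under the pull-back by T_x chi. *)
Definition transform_field (chi : diffeomorphism M M) (mu : measure_field) :
    measure_field :=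
  fun x => push_pullback (tangent_dim_signature x) (tangent_iso chi x) (mu (chi x)).

End MeasureFields.

(* Main.v *)
Require Import Defs.
From HB Require Import structures.
From mathcomp Require Import all_boot all_order all_algebra.
From mathcomp Require Import all_classical all_reals all_analysis.

Set Implicit Arguments.
Unset Strict Implicit.
Unset Printing Implicit Defensive.

(** Two isomorphisms [l, l' : V -> W] satisfy [l' = k \o l] with
    [k = l' \o l^-1] in [GL(W)], so [l'^* = l^* \o k^*] and a [GL(W)]-invariant
    measure has the same image under [l^*] and [l'^*].  Since pull-backs compose
    contravariantly, translating [mu x] by [g], or pulling [mu (chi x)] back by
    [T_x chi], only replaces [l x] by another isomorphism onto the tangent space
    at [x0]. *)

Local Open Scope classical_set_scope.

Section PullbackComposition.
Variables (R : realType) (U V W : vectType R).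

Lemma linIso_comp_bij (l : linIso V W) (k : linIso U V) :
  bijective (l \o k)%VF.
Proof.
apply: (@eq_bij _ _ (l \o k)); first exact: bij_comp (iso_bij l) (iso_bij k).
by move=> u; rewrite comp_lfunE.
Qed.

Definition linIso_comp (l : linIso V W) (k : linIso U V) : linIso U W :=
  LinIso (linIso_comp_bij l k).

Variables (p p' : nat) (hU : \dim {:U} = (p + p')%N).
Variables (hV : \dim {:V} = (p + p')%N) (hW : \dim {:W} = (p + p')%N).

(** Allows an isomorphism to be replaced by one that agrees with it pointwise, so that composites
    need not be identified as records. *)
Lemma eq_pullback (l l' : linIso U W) :
  l =1 l' -> pullback hU l =1 pullback hU l' :> (scalarProd hW -> _).
Proof. by move=> ll' g; apply: sp_inj => v w /=; rewrite /pullback_form !ll'. Qed.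

Lemma pullback_comp (l : linIso V W) (k : linIso U V) (g : scalarProd hW) :
  pullback hU k (pullback hV l g) = pullback hU (linIso_comp l k) g.
Proof.
by apply: sp_inj => v w /=; rewrite /pullback_form /= /pullback_form !comp_lfunE.
Qed.

(** Both sides evaluate [mu] on the same preimage, by contravariance of pull-backs; the equality is
    therefore one of values on every set. *)
Lemma push_pullback_comp (l : linIso V W) (k : linIso U V)
    (mu : borelMeasure R (scalarProd hW)) (A : set (borelType (scalarProd hU))) :
  push_pullback hU k (push_pullback hV l mu) A =
  push_pullback hU (linIso_comp l k) mu A.
Proof.
congr (mu _); apply/seteqP; split=> g;
  by rewrite /preimage /= pullback_comp.
Qed.

End PullbackComposition.

(** With [pullback_invK] and [pullback_continuous], this makes [pullback hV l] a homeomorphism,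
    along which regularity can be transported. *)
Lemma pullbackK (R : realType) (p p' : nat) (V W : vectType R)
    (hV : \dim {:V} = (p + p')%N) (hW : \dim {:W} = (p + p')%N)
    (l : linIso V W) :
  cancel (pullback hV l : scalarProd hW -> _) (pullback hW (linIso_inv l)).
Proof.
by move=> g; apply: sp_inj => v w /=; rewrite /pullback_form /= /pullback_form !linIso_VK.
Qed.

Lemma pullback_invK (R : realType) (p p' : nat) (V W : vectType R)
    (hV : \dim {:V} = (p + p')%N) (hW : \dim {:W} = (p + p')%N)
    (l : linIso V W) :
  cancel (pullback hW (linIso_inv l)) (pullback hV l : scalarProd hW -> _).
Proof.
by move=> g; apply: sp_inj => v w /=; rewrite /pullback_form /= /pullback_form !linIso_K.
Qed.

(** A homeomorphism matches the open, compact and Borel sets of [S] with those of [T], so the infima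
    and suprema defining regularity range over the same values on both sides. *)
Lemma regular_push_homeo (R : realType) (S T : ptopologicalType) (f : S -> T)
    (g : T -> S) (cf : continuous f) (cg : continuous g) (mu : borelMeasure R S) :
  cancel f g -> cancel g f -> regular_measure mu ->
  regular_measure (push_borel cf mu).
Proof.
move=> fK gK [fin_mu out_mu in_mu].
(* Rewriting preimages as images under the inverse map lets compactness pass through preimages;
   [imE] serves the opposite direction. *)
have preE (A : set T) : f @^-1` A = g @` A.
  apply/seteqP; split=> [s As|_ [t At <-]]; first by exists (f s).
  by rewrite /preimage /= gK.
have gfE (B : set S) : f @^-1` (g @^-1` B) = B.
  by apply/seteqP; split=> s; rewrite /preimage /= fK.
have imE (B : set S) : g @^-1` B = f @` B.
  apply/seteqP; split=> [t Bt|_ [s Bs <-]]; first by exists (g t).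
  by rewrite /preimage /= fK.
have compact_g (K : set T) : compact K -> compact (g @` K).
  by apply: continuous_compact; exact: continuous_subspaceT.
have compact_f (K : set S) : compact K -> compact (f @` K).
  by apply: continuous_compact; exact: continuous_subspaceT.
have mpre (A : set (borelType T)) : measurable A ->
    measurable (f @^-1` A : set (borelType S)).
  by move=> mA; rewrite -[_ @^-1` _]setTI; exact: continuous_borel.
split=> [K /compact_g /fin_mu | A /mpre mA | A /mpre mA].
- by rewrite -preE.
- rewrite [LHS](out_mu _ mA); congr ereal_inf; apply/seteqP; split.
    move=> _ [U [oU AU] <-]; exists (g @^-1` U); last by congr (mu _); exact: gfE.
    split; first by move/continuousP: cg; apply.
    by move=> t At; apply: AU; rewrite /preimage /= gK.
  move=> _ [U [oU AU] <-]; exists (f @^-1` U) => //.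
  split; first by move/continuousP: cf; apply.
  by move=> s /AU.
- rewrite [LHS](in_mu _ mA); congr ereal_sup; apply/seteqP; split.
    move=> _ [K [cK KA] <-]; exists (g @^-1` K); last by congr (mu _); exact: gfE.
    split; first by rewrite imE; exact: compact_f.
    by move=> t /KA; rewrite /preimage /= gK.
  move=> _ [K [cK KA] <-]; exists (f @^-1` K) => //.
  split; first by rewrite preE; exact: compact_g.
  by move=> s /KA.
Qed.

Section InvariantTransport.
Variables (R : realType) (p p' : nat) (V W : vectType R).
Variables (hV : \dim {:V} = (p + p')%N) (hW : \dim {:W} = (p + p')%N).
Variables (mu : borelMeasure R (scalarProd hW)) (mu_inv : invariant_measure mu).

Lemma push_pullback_indep (l l' : linIso V W) :
  eq_borel (push_pullback hV l mu) (push_pullback hV l' mu).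
Proof.
move=> A mA.
(* Invariance of [mu] is an equality on Borel sets only, and it will be applied to this preimage. *)
have mlA : measurable (pullback hV l' @^-1` A : set (borelType (scalarProd hW))).
  rewrite -[_ @^-1` _]setTI.
  exact: (continuous_borel (@pullback_continuous _ _ _ _ _ hV hW l')).
pose g := linIso_comp l' (linIso_inv l).
(* The inverse appears because [GL_act] by [g] is the pull-back by the inverse of [g]: acting by [g]
   and then pulling back by [l'] is pulling back by [l]. *)
have gl : linIso_comp (linIso_inv g) l' =1 l.
  move=> v; rewrite /= comp_lfunE /=.
  suff -> : l' v = g (l v) by exact: (linIso_K g).
  by rewrite /= comp_lfunE /= linIso_K.
rewrite [RHS](esym (mu_inv.2 g _ mlA)).
congr (mu _); apply/seteqP; split=> h; rewrite /preimage /= /GL_act pullback_comp.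
  by rewrite (eq_pullback _ gl).
by rewrite (eq_pullback _ gl).
Qed.

Lemma push_pullback_invariant (l : linIso V W) :
  invariant_measure (push_pullback hV l mu).
Proof.
split.
  apply: regular_push_homeo mu_inv.1; last 2 first.
  - exact: pullbackK.
  - exact: pullback_invK.
  exact: pullback_continuous.
move=> g A mA.
(* The translate by [g] is the push-forward along the pull-back by [l] composed with the inverse of
   [g], again an isomorphism from [V] to [W]. *)
rewrite [LHS](push_pullback_comp hV l (linIso_inv g) mu A).
exact: push_pullback_indep.
Qed.

End InvariantTransport.

Theorem mainTheorem2 (R : realType) (n p p' : nat) (n_gt0 : (0 < n)%N)
    (hpp : (p + p')%N = n) (M : smoothManifold R n) (x0 : M)
    (mu0 : borelMeasure R (Gamma hpp x0)) (mu0_inv : invariant_measure mu0)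
    (l : forall x : M, linIso (tangent M x) (tangent M x0)) :
  let mu : measure_field hpp M :=
    fun x => push_pullback (tangent_dim_signature hpp x) (l x) mu0 in
  [/\ forall (x : M) (l' : linIso (tangent M x) (tangent M x0)),
        eq_borel (push_pullback (tangent_dim_signature hpp x) l' mu0) (mu x),
      forall x : M, invariant_measure (mu x) &
      forall (chi : diffeomorphism M M) (x : M),
        eq_borel (transform_field chi mu x) (mu x)].
Proof.
move=> mu; split=> [x l'|x|chi x A mA].
- exact: push_pullback_indep.
- exact: push_pullback_invariant.
(* The transformed field at [x] arises from [mu0] through the isomorphism [l (chi x)] composed with
   the tangent map of [chi] at [x]. *)
- rewrite [LHS]push_pullback_comp.
  exact: push_pullback_indep.
Qed.
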